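(* Let $\mathbb{F}$ be a field of characteristic $0$, let $\mathbb{V}$ be an $n$-dimensional vector space over $\mathbb{F}$ with a basis $b_1,\dots,b_n$, and let $(\cdot,\cdot)$ be the symmetric bilinear form on $\mathbb{V}$ with $(b_i,b_j)=\delta_{ij}$. Let $\mathbb{A}$ be the ternary algebra on $\mathbb{V}$ with product $[x,y,z]=(y,z)x+(x,z)y+(x,y)z$. Then $\mathbb{A}$ is a ternary Jordan algebra.
   Context: A ternary algebra with trilinear product $[\cdot,\cdot,\cdot]$ is a ternary Jordan algebra if (i) the product is totally commutative, i.e. $[x_{\sigma(1)},x_{\sigma(2)},x_{\sigma(3)}]=[x_1,x_2,x_3]$ for all permutations $\sigma\in S_3$; and (ii) for all pairs $x=(x_1,x_2)$, $y=(y_1,y_2)$ of elements, the linear map $D_{x,y}(z)=[[z,x_1,x_2],y_1,y_2]-[[z,y_1,y_2],x_1,x_2]$ is a derivation: $D_{x,y}[z_1,z_2,z_3]=[D_{x,y}(z_1),z_2,z_3]+[z_1,D_{x,y}(z_2),z_3]+[z_1,z_2,D_{x,y}(z_3)]$ for all $z_1,z_2,z_3$. *)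

(* Defs.v *)
From HB Require Import structures.
From mathcomp Require Import all_boot all_fingroup all_algebra.

Set Implicit Arguments.
Unset Strict Implicit.
Unset Printing Implicit Defensive.

Import GRing.Theory.
Local Open Scope ring_scope.

Section TernaryAlgebra.

Variables (F : fieldType) (V : lmodType F).
Implicit Types (p : V -> V -> V -> V) (x y : V * V) (D : V -> V).

Definition trilinear p : Prop :=
  [/\ forall v w, linear (fun u => p u v w),
      forall u w, linear (fun v => p u v w)
    & forall u v, linear (fun w => p u v w)].

Definition totally_commutative p : Prop :=
  forall (s : 'S_3) (u : 'I_3 -> V),
    p (u (s 0)) (u (s 1)) (u (s 2)) = p (u 0) (u 1) (u 2).

Definition ternary_derivation p D : Prop :=
  linear D /\
  forall z1 z2 z3, D (p z1 z2 z3) = p (D z1) z2 z3 + p z1 (D z2) z3 + p z1 z2 (D z3).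

(* Commutator of the multiplications z |-> [z, x1, x2] and z |-> [z, y1, y2]. *)
Definition ternary_D p x y : V -> V := fun z =>
  p (p z x.1 x.2) y.1 y.2 - p (p z y.1 y.2) x.1 x.2.

(* Trilinearity is part of being a ternary algebra, so it is required here. *)
Definition ternary_jordan_algebra p : Prop :=
  [/\ trilinear p,
      totally_commutative p
    & forall x y, ternary_derivation p (ternary_D p x y)].

End TernaryAlgebra.

Definition form_product (F : fieldType) (V : lmodType F) (form : V -> V -> F)
    (x y z : V) : V :=
  form y z *: x + form x z *: y + form x y *: z.

(* Main.v *)
Require Import Defs.
From mathcomp Require Import all_boot all_fingroup all_algebra.
From mathcomp Require Import ring.

Import GRing.Theory.
Local Open Scope ring_scope.

(** Every multiplication z |-> [z, a, b] is self-adjoint for the form: it is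
    (a, b) times the identity plus z |-> (z, b) a + (z, a) b, and both summands
    are self-adjoint because the form is symmetric
    ([form_product_selfadjoint]). Hence the commutator D_{x,y} of two
    multiplications is skew-adjoint ([ternary_D_skewadjoint]).

    Now the product is built from the form alone, so it is preserved by the
    infinitesimal isometries of the form, that is, by the skew-adjoint linear
    maps: they are derivations ([skewadjoint_derivation]). This proves the
    Jordan identity. It remains to see that the product is trilinear and
    totally commutative; for the latter it suffices to test two
    adjacent transpositions ([totally_commutative_transpositions]). *)

(** The two adjacent transpositions generate S_3. As the group is so small, the
    proof inspects the possible images of 0, 1 and 2 instead of decomposing the
    permutation into transpositions. *)
Lemma totally_commutative_transpositions (F : fieldType) (V : lmodType F)
    (p : V -> V -> V -> V) :
  (forall x y z, p y x z = p x y z) -> (forall x y z, p x z y = p x y z) ->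
  totally_commutative p.
Proof.
move=> p12 p23 s u.
have ordE (i : 'I_3) : [\/ i = 0, i = 1 | i = 2].
  by case: i => [[|[|[|//]]] lti3]; [apply: Or31 | apply: Or32 | apply: Or33];
    apply: val_inj.
have s01 : s 0 != s 1 by rewrite (inj_eq perm_inj).
have s02 : s 0 != s 2 by rewrite (inj_eq perm_inj).
have s12 : s 1 != s 2 by rewrite (inj_eq perm_inj).
have p13 x y z : p z y x = p x y z by rewrite p12 p23 p12.
have pcycle x y z : p y z x = p x y z by rewrite p23 p12.
by case: (ordE (s 0)) s01 s02 => ->; case: (ordE (s 1)) s12 => ->;
  case: (ordE (s 2)) => -> // *; rewrite ?p12 ?p23 // ?p13 ?pcycle.
Qed.

Section SymmetricForm.

Context (F : fieldType) (V : lmodType F) (form : {symmetric V}).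
Local Notation p := (form_product form).

Lemma symmetric_formC u v : form u v = form v u.
Proof. by rewrite hermC expr0 mul1r. Qed.

Lemma form_product_linear v w : linear (fun u => p u v w).
Proof.
move=> k u u'; rewrite /form_product !linearPl /=.
rewrite !scalerDr !scalerDl !scalerA ![k * _]mulrC.
by rewrite [LHS](AC (2*2*2) ((1*3*5)*(2*4*6))).
Qed.

Lemma form_product_swap12 x y z : p y x z = p x y z.
Proof.
by rewrite /form_product [form y x]symmetric_formC [form x z *: y + _]addrC.
Qed.

Lemma form_product_swap23 x y z : p x z y = p x y z.
Proof. by rewrite /form_product [form z y]symmetric_formC addrAC. Qed.

Lemma form_product_trilinear : trilinear p.
Proof.
split; first exact: form_product_linear.
  move=> u w k v v'; rewrite -!(form_product_swap12 u).
  exact: form_product_linear.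
move=> u v k w w'; rewrite -!(form_product_swap23 u v) -!(form_product_swap12 u).
exact: form_product_linear.
Qed.

Lemma form_product_selfadjoint a b z w : form (p z a b) w = form z (p w a b).
Proof.
rewrite /form_product !linearDl !linearDr !linearZl_LR !linearZr_LR /=.
by rewrite ![form _ w]symmetric_formC; ring.
Qed.

(** A commutator of self-adjoint maps is skew-adjoint. *)
Lemma ternary_D_skewadjoint x y z w :
  form (ternary_D p x y z) w = - form z (ternary_D p x y w).
Proof.
by rewrite /ternary_D linearBl linearBr /= !form_product_selfadjoint opprB.
Qed.

(** Applied to [z1, z2, z3], the map D acts on the vector z_i in each of the
    terms (z_j, z_k) z_i of the product. The Leibniz rule asks for the extra
    terms ((D z_j, z_k) + (z_j, D z_k)) z_i, and these vanish. *)
Lemma skewadjoint_derivation (D : V -> V) :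
  linear D -> (forall z w, form (D z) w = - form z (D w)) ->
  ternary_derivation p D.
Proof.
move=> linD skewD; split=> // z1 z2 z3.
have DD u v : D (u + v) = D u + D v by have := linD 1 u v; rewrite !scale1r.
have D0 : D 0 = 0 by apply: (addrI (D 0)); rewrite -DD !addr0.
have DZ k u : D (k *: u) = k *: D u by have := linD k u 0; rewrite D0 !addr0.
rewrite /form_product !DD !DZ.
(* Separate the image of the product from the extra terms, the latter paired
   by the vector z_i that they multiply. *)
rewrite [RHS](AC (3*3*3) ((1*5*9)*((4*7)*(2*8)*(3*6)))) /=.
by rewrite -!scalerDl !skewD !addNr !scale0r !addr0.
Qed.

Lemma ternary_D_linear x y : linear (ternary_D p x y).
Proof.
move=> k u v; rewrite /ternary_D !form_product_linear.
by rewrite scalerBr opprD addrACA.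
Qed.

Lemma form_product_jordan : ternary_jordan_algebra p.
Proof.
split; first exact: form_product_trilinear.
  apply: totally_commutative_transpositions; first exact: form_product_swap12.
  exact: form_product_swap23.
move=> x y; apply: skewadjoint_derivation; first exact: ternary_D_linear.
exact: ternary_D_skewadjoint.
Qed.

End SymmetricForm.

Theorem theorem5 (F : fieldType) (charF0 : [pchar F] =i pred0)
    (V : vectType F) (n : nat) (b : n.-tuple V) (b_basis : basis_of fullv b)
    (form : {symmetric V})
    (form_b : forall i j : 'I_n, form (tnth b i) (tnth b j) = (i == j)%:R) :
  ternary_jordan_algebra (form_product form).
Proof. exact: form_product_jordan. Qed.
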